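(* The class $\mathcal{R}$ of all $*$-regular rings (with or without unit), regarded as algebras in the signature consisting of the ring operations $+,-,\cdot,0$, the unary involution $^*$ and the unary relative-inverse operation $q$, forms a variety; that is, $\mathcal{R}$ is closed under arbitrary products, homomorphic images and subalgebras (substructures) with respect to this signature.
   Context: Rings are associative and need not have a unit. An involution on a ring $R$ is an anti-automorphism $x\mapsto x^*$ of $R$ with $(x^* )^*=x$. A ring $R$ is (von Neumann) regular if for every $x\in R$ there is $y\in R$ with $xyx=x$. A $*$-regular ring is a regular ring with involution such that $xx^*=0$ implies $x=0$. A projection is an element $p$ with $p^2=p^*=p$. In a $*$-regular ring $R$, for each $a\in R$ there is a unique projection $l(a)$ generating the principal right ideal $aR$ (left projection of $a$) and a unique projection $r(a)$ generating the principal left ideal $Ra$ (right projection of $a$). The relative inverse $q(a)$ of $a$ is the unique element of $R$ satisfying $r(a)\,q(a)=q(a)$ and $a\,q(a)=l(a)$ (it then also satisfies $q(a)\,a=r(a)$). This defines the unary operation $q:R\to R$ included in the signature. *)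

(* Defs.v *)
From mathcomp Require Import ssreflect ssrfun ssrbool.

Set Implicit Arguments.
Unset Strict Implicit.
Unset Printing Implicit Defensive.

Declare Scope alg_scope.
Delimit Scope alg_scope with alg.
Local Open Scope alg_scope.

(* A bare algebra in the signature (+, -, 0, ., *, q): no axiom is imposed on
   the operations. The symbol - is read as the unary opposite. *)
Record algebra := Algebra {
  carrier :> Type;
  add : carrier -> carrier -> carrier;
  opp : carrier -> carrier;
  zero : carrier;
  mul : carrier -> carrier -> carrier;
  star : carrier -> carrier;
  rinv : carrier -> carrier }.

Arguments zero {_}.

Notation "x + y" := (add x y) : alg_scope.
Notation "- x" := (opp x) : alg_scope.
Notation "0" := zero : alg_scope.
Notation "x * y" := (mul x y) : alg_scope.
Notation "x ^*" := (star x) : alg_scope.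

Record is_ring (A : algebra) : Prop := IsRing {
  ring_addA : associative (@add A);
  ring_addC : commutative (@add A);
  ring_add0 : left_id 0 (@add A);
  ring_addN : left_inverse 0 (@opp A) (@add A);
  ring_mulA : associative (@mul A);
  ring_mulDl : left_distributive (@mul A) (@add A);
  ring_mulDr : right_distributive (@mul A) (@add A) }.

Record is_involution (A : algebra) : Prop := IsInvolution {
  inv_starD : {morph @star A : x y / x + y};
  inv_starM : forall x y : A, (x * y)^* = y^* * x^*;
  inv_starK : involutive (@star A) }.

Definition is_regular (A : algebra) : Prop :=
  forall x : A, exists y : A, x * y * x = x.

Record is_star_regular_ring (A : algebra) : Prop := IsStarRegularRing {
  sr_ring : is_ring A;
  sr_inv : is_involution A;
  sr_regular : is_regular A;
  sr_proper : forall x : A, x * x^* = 0 -> x = 0 }.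

Definition is_projection (A : algebra) (p : A) : Prop :=
  p * p = p /\ p^* = p.

(* In a regular ring a = a (y a) = (a y) a, so aR and Ra contain a, and they are
   the principal one-sided ideals generated by a even without a unit. *)
Definition in_right_ideal (A : algebra) (a x : A) : Prop :=
  exists y : A, x = a * y.

Definition in_left_ideal (A : algebra) (a x : A) : Prop :=
  exists y : A, x = y * a.

Definition is_left_projection (A : algebra) (a p : A) : Prop :=
  is_projection p /\ forall x : A, in_right_ideal p x <-> in_right_ideal a x.

Definition is_right_projection (A : algebra) (a p : A) : Prop :=
  is_projection p /\ forall x : A, in_left_ideal p x <-> in_left_ideal a x.

(* In a *-regular ring, l, r and b are uniquely determined by a: see
   left_projection_unique_exists, right_projection_unique_exists and
   relative_inverse_unique_exists below. *)
Definition is_relative_inverse (A : algebra) (a b : A) : Prop :=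
  exists l r : A, [/\ is_left_projection a l, is_right_projection a r,
                      r * b = b & a * b = l].

Definition star_regular (A : algebra) : Prop :=
  is_star_regular_ring A /\ forall a : A, is_relative_inverse a (rinv a).

Definition product_algebra (I : Type) (A : I -> algebra) : algebra :=
  @Algebra (forall i, A i)
    (fun x y i => x i + y i) (fun x i => - x i) (fun i => 0)
    (fun x y i => x i * y i) (fun x i => (x i)^*) (fun x i => rinv (x i)).

Record is_hom (A B : algebra) (f : A -> B) : Prop := IsHom {
  hom_add : {morph f : x y / x + y};
  hom_opp : {morph f : x / - x};
  hom_zero : f 0 = 0;
  hom_mul : {morph f : x y / x * y};
  hom_star : {morph f : x / x^*};
  hom_rinv : {morph f : x / rinv x} }.

Record is_subuniverse (A : algebra) (S : A -> Prop) : Prop := IsSubuniverse {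
  sub_add : forall x y, S x -> S y -> S (x + y);
  sub_opp : forall x, S x -> S (- x);
  sub_zero : S 0;
  sub_mul : forall x y, S x -> S y -> S (x * y);
  sub_star : forall x, S x -> S x^*;
  sub_rinv : forall x, S x -> S (rinv x) }.

Definition subalgebra (A : algebra) (S : A -> Prop) (hS : is_subuniverse S) :
    algebra :=
  @Algebra {x : A | S x}
    (fun x y => exist S _ (sub_add hS (proj2_sig x) (proj2_sig y)))
    (fun x => exist S _ (sub_opp hS (proj2_sig x)))
    (exist S _ (sub_zero hS))
    (fun x y => exist S _ (sub_mul hS (proj2_sig x) (proj2_sig y)))
    (fun x => exist S _ (sub_star hS (proj2_sig x)))
    (fun x => exist S _ (sub_rinv hS (proj2_sig x))).

Definition closed_under_products (K : algebra -> Prop) : Prop :=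
  forall (I : Type) (A : I -> algebra),
    (forall i, K (A i)) -> K (product_algebra A).

Definition closed_under_hom_images (K : algebra -> Prop) : Prop :=
  forall (A B : algebra) (f : A -> B),
    is_hom f -> (forall b, exists a, f a = b) -> K A -> K B.

Definition closed_under_subalgebras (K : algebra -> Prop) : Prop :=
  forall (A : algebra) (S : A -> Prop) (hS : is_subuniverse S),
    K A -> K (subalgebra hS).

Definition is_variety (K : algebra -> Prop) : Prop :=
  [/\ closed_under_products K, closed_under_hom_images K
    & closed_under_subalgebras K].

Lemma ring_subr_eq0 (A : algebra) (x y : A) :
  is_ring A -> x + - y = 0 -> x = y.
Proof.
move=> h E; have := ring_addA h x (- y) y.
by rewrite (ring_addN h) E (ring_add0 h) (ring_addC h) (ring_add0 h).
Qed.

Lemma ring_add_idem (A : algebra) (x : A) : is_ring A -> x + x = x -> x = 0.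
Proof.
move=> h E; have := ring_addA h (- x) x x.
by rewrite E (ring_addN h) (ring_add0 h).
Qed.

Lemma ring_mulr0 (A : algebra) (x : A) : is_ring A -> x * 0 = 0.
Proof.
move=> h; apply: (ring_add_idem h).
by rewrite -(ring_mulDr h) (ring_add0 h).
Qed.

Lemma ring_mul0r (A : algebra) (x : A) : is_ring A -> 0 * x = 0.
Proof.
move=> h; apply: (ring_add_idem h).
by rewrite -(ring_mulDl h) (ring_add0 h).
Qed.

Lemma ring_subrr (A : algebra) (x : A) : is_ring A -> x + - x = 0.
Proof. by move=> h; rewrite (ring_addC h) (ring_addN h). Qed.

Lemma ring_mulrB_eq0 (A : algebra) (c x y : A) :
  is_ring A -> c * x = c * y -> c * (x + - y) = 0.
Proof.
move=> h E; rewrite (ring_mulDr h) E -(ring_mulDr h) (ring_subrr _ h).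
exact: ring_mulr0.
Qed.

Lemma star_cancel (A : algebra) (a u : A) :
  is_star_regular_ring A -> a^* * a * u = a^* * a -> a * u = a.
Proof.
move=> h; have hr := sr_ring h; have hi := sr_inv h.
rewrite -(ring_mulA hr) => E.
have az := ring_mulrB_eq0 hr E.
set z := _ + _ in az; apply: (ring_subr_eq0 hr); rewrite -/z.
have star0 : (0 : A)^* = 0.
  by apply: (ring_add_idem hr); rewrite -(inv_starD hi) (ring_add0 hr).
have oaz : (- a)^* * z = 0.
  have := ring_mul0r z hr.
  rewrite -{1}star0 -(ring_subrr a hr) (inv_starD hi) (ring_mulDl hr) az.
  by rewrite (ring_add0 hr).
have zz : z^* * z = 0.
  rewrite {1}/z (inv_starD hi) (ring_mulDl hr) oaz (inv_starM hi).
  by rewrite -(ring_mulA hr) az (ring_mulr0 _ hr) (ring_add0 hr).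
rewrite -(inv_starK hi z) [z^*](sr_proper h) ?star0 //.
by rewrite (inv_starK hi).
Qed.

Lemma left_projection_unique_exists (A : algebra) (a : A) :
  is_star_regular_ring A -> exists! p, is_left_projection a p.
Proof.
move=> h; have hr := sr_ring h; have hi := sr_inv h.
have mulA := ring_mulA hr; have [y yE] := sr_regular h (a^* * a).
have aE : a * y * a^* * a = a.
  by have := @star_cancel _ a (y * (a^* * a)) h; rewrite !mulA in yE *; apply.
have aE' : a * y^* * a^* * a = a.
  have := @star_cancel _ a (y^* * (a^* * a)) h.
  have := congr1 (@star A) yE.
  by rewrite !(inv_starM hi) (inv_starK hi) !mulA => E; apply.
pose p := a * y * a^*.
have psE : p^* = a * y^* * a^* by rewrite !(inv_starM hi) (inv_starK hi) mulA.
have pp : p * p^* = p^* by rewrite psE !mulA aE.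
have ps : p^* = p.
  by have := congr1 (@star A) pp; rewrite (inv_starM hi) (inv_starK hi) pp.
exists p; split.
  split=> [|x]; first by split=> //; rewrite -{2}ps pp.
  split=> -[t ->]; first by exists (y * (a^* * t)); rewrite /p !mulA.
  by exists (a * t); rewrite !mulA aE.
move=> p' [[p'2 p's] p'I].
have e1 : p' * p = p.
  have [|t pE] := (proj2 (p'I p)); first by exists (y * a^*); rewrite mulA.
  by rewrite {1}pE mulA p'2 -pE.
have e2 : p * p' = p'.
  have [|t p'E] := (proj1 (p'I p')); first by exists p'.
  by rewrite {1}p'E /p mulA aE -p'E.
by have := congr1 (@star A) e1; rewrite (inv_starM hi) ps p's e2.
Qed.

Lemma left_ideal_star (A : algebra) (a x : A) :
  is_involution A -> in_left_ideal a x <-> in_right_ideal a^* x^*.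
Proof.
move=> hi; split=> -[y E]; exists y^*; first by rewrite E (inv_starM hi).
by rewrite -(inv_starK hi x) E (inv_starM hi) (inv_starK hi).
Qed.

Lemma right_projection_star (A : algebra) (a p : A) :
  is_involution A -> is_right_projection a p <-> is_left_projection a^* p.
Proof.
move=> hi; have L := @left_ideal_star A _ _ hi.
split=> -[pP pI]; split=> // x; have ps := proj2 pP.
  have := L p x^*; have := L a x^*; have := pI x^*.
  by rewrite (inv_starK hi) ps; tauto.
by have := L p x; have := L a x; have := pI x^*; rewrite ps; tauto.
Qed.

Lemma right_projection_unique_exists (A : algebra) (a : A) :
  is_star_regular_ring A -> exists! p, is_right_projection a p.
Proof.
move=> h; have hi := sr_inv h.
have [p [pP pU]] := left_projection_unique_exists a^* h.
exists p; split; first exact/right_projection_star.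
by move=> p' /(right_projection_star _ _ hi)/pU.
Qed.

Lemma relative_inverse_unique_exists (A : algebra) (a : A) :
  is_star_regular_ring A -> exists! b, is_relative_inverse a b.
Proof.
move=> h; have mulA := ring_mulA (sr_ring h).
have [l [lP lU]] := left_projection_unique_exists a h.
have [r [rP rU]] := right_projection_unique_exists a h.
have [[l2 _] lI] := lP; have [[r2 _] rI] := rP.
have [|t lE] := proj1 (lI l); first by exists l.
have [|s rE] := proj1 (rI r); first by exists r.
have ar : a * r = a.
  have [y yE] := sr_regular h a.
  have [|u aE] := proj2 (rI a); first by exists (a * y); rewrite yE.
  by rewrite {1}aE -mulA r2 -aE.
exists (r * t); split.
  by exists l, r; split=> //; rewrite mulA ?r2 ?ar.
move=> b [l' [r' [/lU <- /rU <- rb ab]]].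
by rewrite -rb rE -!mulA ab {1}lE.
Qed.

(* Main.v *)
From mathcomp Require Import ssreflect ssrfun ssrbool.
From Stdlib Require Import FunctionalExtensionality ProofIrrelevance.
Require Import Defs.

(** The class is axiomatised by identities: the ring and involution identities,
    the Moore-Penrose identities for [a] and [q a], and
    [a * (q (a^* * a) * (a^* * a)) = a]. The last one replaces the implication
    [x * x^* = 0 -> x = 0], the only axiom that is not obviously equational.
    Identities pass to products, homomorphic images and subalgebras. *)

Set Implicit Arguments.
Unset Strict Implicit.
Unset Printing Implicit Defensive.

Local Open Scope alg_scope.

Record star_regular_identities (A : algebra) : Prop := StarRegularIdentities {
  id_ring : is_ring A;
  id_inv : is_involution A;
  id_mulVK : forall a : A, a * rinv a * a = a;
  id_Vmul : forall a : A, rinv a * a * rinv a = rinv a;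
  id_starl : forall a : A, (a * rinv a)^* = a * rinv a;
  id_starr : forall a : A, (rinv a * a)^* = rinv a * a;
  id_proper : forall a : A, a * (rinv (a^* * a) * (a^* * a)) = a }.

(** With [a * b = l] given, everything reduces to [l * a = a], where regularity puts [a] in its own
    right ideal, and to [b * a = r]. *)
Lemma relative_inverse_penrose (A : algebra) (a b : A) :
  is_star_regular_ring A -> is_relative_inverse a b ->
  [/\ a * b * a = a, b * a * b = b, (a * b)^* = a * b & (b * a)^* = b * a].
Proof.
move=> h [l [r [[[l2 ls] lI] [[r2 rs] rI] rb ab]]].
have mulA := ring_mulA (sr_ring h); have [y yE] := sr_regular h a.
have la : l * a = a.
  have [|t aE] := proj2 (lI a); first by exists (y * a); rewrite mulA yE.
  by rewrite {1}aE mulA l2 -aE.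
have [|s rE] := proj1 (rI r); first by exists r.
(* Writing [r = s * a] gives [b * a = r * b * a = s * (a * b) * a = s * (l * a) = s * a = r]. *)
have ba : b * a = r by rewrite -rb rE -mulA -mulA [a * _]mulA ab la.
by rewrite ab ba.
Qed.

Lemma star_regular_has_identities (A : algebra) :
  star_regular A -> star_regular_identities A.
Proof.
move=> [h hq]; have P a := relative_inverse_penrose h (hq a).
split; [exact: sr_ring h|exact: sr_inv h|..] => a; try by have [] := P a.
(* Cancelling [a^*] on the left leaves the first Penrose identity at [a^* * a]. *)
apply: (star_cancel h); have [+ _ _ _] := P (a^* * a).
by rewrite !(ring_mulA (sr_ring h)).
Qed.

Lemma identities_star_regular (A : algebra) :
  star_regular_identities A -> star_regular A.
Proof.
move=> h; have hr := id_ring h; have hi := id_inv h; have mulA := ring_mulA hr.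
split.
  split=> // [x|x xx0]; first by exists (rinv x); exact: id_mulVK.
  (* [id_proper] at [x^*] contains the factor [x * x^*], which is zero by assumption. *)
  have x0 : x^* = 0.
    by rewrite -(id_proper h x^*) (inv_starK hi) xx0 !(ring_mulr0 _ hr).
  by rewrite -(id_proper h x) x0 (ring_mul0r _ hr) !(ring_mulr0 _ hr).
move=> a; exists (a * rinv a), (rinv a * a); split=> //; last exact: id_Vmul.
  split; first by split; [rewrite mulA (id_mulVK h)|exact: id_starl].
  move=> x; split=> -[t ->]; first by exists (rinv a * t); rewrite mulA.
  by exists (a * t); rewrite mulA (id_mulVK h).
split; first by split; [rewrite mulA (id_Vmul h)|exact: id_starr].
move=> x; split=> -[t ->]; first by exists (t * rinv a); rewrite mulA.
by exists (t * a); rewrite -mulA [a * _]mulA (id_mulVK h).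
Qed.

Definition hom_ops (A B : algebra) (f : A -> B) (h : is_hom f) :=
  (hom_add h, hom_opp h, hom_mul h, hom_star h, hom_rinv h).

(** An identity may be tested after each [f i], where it becomes an instance of the same identity in
    [B i]. This covers products, through the coordinate maps, and subalgebras, through the single
    inclusion. *)
Lemma identities_separating (A : algebra) (I : Type) (B : I -> algebra)
    (f : forall i, A -> B i) :
  (forall i, is_hom (f i)) -> (forall x y, (forall i, f i x = f i y) -> x = y) ->
  (forall i, star_regular_identities (B i)) -> star_regular_identities A.
Proof.
move=> hf inj hB.
split; [split|split|..].
all: repeat (let x := fresh "x" in intro x); apply: inj => i;
  rewrite ?(hom_zero (hf i), hom_ops (hf i)).
all: have [[? ? ? ? ? ? ?] [? ? ?] ? ? ? ? ?] := hB i; auto.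
Qed.

(** Replacing variables by preimages makes each side of an identity in [B] the image under [f] of
    the same term in [A]. *)
Lemma identities_hom_image (A B : algebra) (f : A -> B) :
  is_hom f -> (forall b, exists a, f a = b) ->
  star_regular_identities A -> star_regular_identities B.
Proof.
move=> hf surj [[? ? ? ? ? ? ?] [? ? ?] ? ? ? ? ?].
split; [split|split|..].
all: repeat (let x := fresh "x" in intro x; have [? <-] := surj x);
  rewrite -?(hom_zero hf) -?(hom_ops hf); congr f; auto.
Qed.

Theorem theorem2p6 : is_variety star_regular.
Proof.
split.
- move=> I A hA; apply: identities_star_regular.
  apply: (@identities_separating (product_algebra A) I A (fun i x => x i)) => //.
    by move=> x y; exact: functional_extensionality_dep.
  by move=> i; exact: star_regular_has_identities.
- move=> A B f hf surj /star_regular_has_identities hA.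
  exact/identities_star_regular/(identities_hom_image hf surj).
- move=> A S hS /star_regular_has_identities hA; apply: identities_star_regular.
  apply: (@identities_separating (subalgebra hS) unit (fun=> A)
    (fun=> @proj1_sig A S)) => //.
  (* Elements of the subalgebra carry membership proofs, so injectivity of the inclusion rests on
     proof irrelevance. *)
  move=> [x Sx] [y Sy] /(_ tt) /= xy; move: Sx Sy; rewrite xy => Sx Sy.
  by rewrite (proof_irrelevance _ Sx Sy).
Qed.
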